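(* For every $n\ge 3$, the cycle $C_n$ on $n$ vertices satisfies $\chi_\ell^\star(C_n)=3$ and $\chi_c^\star(C_n)=4$.
   Context: A correspondence-cover of a graph $G$ is a pair $(L,H)$ where $H$ is a graph and $L:V(G)\to 2^{V(H)}$ is such that: the sets $L(v)$ partition $V(H)$; for distinct non-adjacent $u,v$ there are no edges of $H$ between $L(u)$ and $L(v)$; for $uv\in E(G)$ the edges of $H$ between $L(u)$ and $L(v)$ form a matching; each $L(v)$ induces a clique in $H$. It is $k$-fold if $|L(v)|=k$ for all $v$. A $k$-list-assignment $L$ assigns each vertex a set $L(v)\subseteq\mathbb{N}$ of size $k$; its list-cover has vertices $x_v$ ($v\in V(G)$, $x\in L(v)$), cliques on each $\{x_v:x\in L(v)\}$, and edges $x_ux_v$ for each $uv\in E(G)$ and $x\in L(u)\cap L(v)$. The list packing number $\chi_\ell^\star(G)$ is the least $k$ such that for every $k$-list-assignment the associated list-cover has chromatic number $k$ (equivalently, there are $k$ pairwise disjoint proper $L$-colourings). The correspondence packing number $\chi_c^\star(G)$ is the least $k$ such that every $k$-fold correspondence-cover $(L,H)$ of $G$ has $\chi(H)=k$. *)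

(* Defs.v *)
From mathcomp Require Import all_boot.
From mathcomp Require Import finmap.

Set Implicit Arguments.
Unset Strict Implicit.
Unset Printing Implicit Defensive.

Record sgraph := SGraph {
  svertex :> finType;
  sedge : rel svertex;
  sedge_sym : symmetric sedge;
  sedge_irr : irreflexive sedge
}.

Definition colorable (H : sgraph) (k : nat) : bool :=
  [exists f : {ffun H -> 'I_k},
    [forall x, [forall y, sedge x y ==> (f x != f y)]]].

Lemma colorable_card (H : sgraph) : exists k, colorable H k.
Proof.
exists #|H|; apply/existsP; exists [ffun x => enum_rank x].
apply/forallP=> x; apply/forallP=> y; apply/implyP=> exy; rewrite !ffunE.
by apply: contraTneq exy => /enum_rank_inj ->; rewrite sedge_irr.
Qed.

Definition chi (H : sgraph) : nat := ex_minn (colorable_card H).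

Definition edges_between (H : sgraph) (A B : {set H}) : {set {set H}} :=
  [set [set x; y] | x in A, y in B & sedge x y].

(* [trivIset M] says that the edges in [M] are pairwise disjoint. *)
Definition is_matching (H : sgraph) (M : {set {set H}}) : Prop := trivIset M.

Record correspondence_cover (G H : sgraph) (L : G -> {set H}) : Prop :=
  CorrespondenceCover {
    cover_disjoint : forall u v : G, u != v -> [disjoint L u & L v];
    cover_full : \bigcup_(v : G) L v = [set: H];
    cover_nonadjacent : forall u v : G, u != v -> ~~ sedge u v ->
      edges_between (L u) (L v) = set0;
    cover_adjacent : forall u v : G, sedge u v ->
      is_matching (edges_between (L u) (L v));
    cover_clique : forall (v : G) (x y : H),
      x \in L v -> y \in L v -> x != y -> sedge x y
  }.

Definition fold_cover (k : nat) (G H : sgraph) (L : G -> {set H}) : Prop :=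
  correspondence_cover L /\ forall v : G, #|L v| = k.

Definition list_assignment (k : nat) (G : sgraph) (L : G -> {fset nat}) :
  Prop := forall v : G, #|` L v|%fset = k.

Section ListCover.
Variables (G : sgraph) (L : G -> {fset nat}).

(* The pair [Tagged _ x], with tag [v] and [x : L v], is the vertex x_v. *)
Definition list_cover_vertex : finType := {v : G & L v}.

Definition list_cover_color (p : list_cover_vertex) : nat := fsval (tagged p).

Definition list_cover_edge : rel list_cover_vertex :=
  [rel p q | (tag p == tag q) && (p != q)
          || sedge (tag p) (tag q) && (list_cover_color p == list_cover_color q)].

Lemma list_cover_sym : symmetric list_cover_edge.
Proof.
move=> p q; rewrite /list_cover_edge /= (eq_sym (tag p)) (eq_sym p) sedge_sym.
by rewrite (eq_sym (list_cover_color p)).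
Qed.

Lemma list_cover_irr : irreflexive list_cover_edge.
Proof. by move=> p; rewrite /list_cover_edge /= !eqxx sedge_irr. Qed.

Definition list_cover : sgraph := SGraph list_cover_sym list_cover_irr.
End ListCover.

Definition is_least (P : nat -> Prop) (k : nat) : Prop :=
  P k /\ forall j, P j -> k <= j.

(* Packing numbers are minima over k >= 1: for k = 0 the cover is the empty
   graph, whose chromatic number is 0, so the condition would hold trivially. *)
Definition list_packing_number (G : sgraph) : nat -> Prop :=
  is_least (fun k => 0 < k /\
    forall L : G -> {fset nat}, list_assignment k L -> chi (list_cover L) = k).

Definition correspondence_packing_number (G : sgraph) : nat -> Prop :=
  is_least (fun k => 0 < k /\
    forall (H : sgraph) (L : G -> {set H}), fold_cover k L -> chi H = k).

(* [ordS] is the successor modulo n; [i != j] only matters when n = 1. *)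
Definition cycle_edge (n : nat) : rel 'I_n :=
  [rel i j | (i != j) && ((j == ordS i) || (i == ordS j))].

Lemma cycle_edge_sym (n : nat) : symmetric (@cycle_edge n).
Proof. by move=> i j; rewrite /cycle_edge /= eq_sym orbC. Qed.

Lemma cycle_edge_irr (n : nat) : irreflexive (@cycle_edge n).
Proof. by move=> i; rewrite /cycle_edge /= eqxx. Qed.

Definition cycle_graph (n : nat) : sgraph :=
  SGraph (@cycle_edge_sym n) (@cycle_edge_irr n).

(* Main.v *)
Require Import Defs.
From mathcomp Require Import all_boot.
From mathcomp Require Import all_algebra perm finmap.

(* Upper bounds: cut the cycle at one edge r -> r+1.  Following the matchings
   along the remaining path gives each vertex of a k-fold cover a coordinate c
   in Z/k, injective on every fibre and constant along all the uncut edges.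
   Colour x over the vertex i by c x + s i, where s : path -> Z/k changes at
   every step.  As n >= 3 and k >= 3, the total shift t between the ends of s
   is arbitrary, so only a t with c y <> c x + t for all the cover edges xy over
   the cut edge is needed.  If none exists, then each t is the difference of
   some matched pair, so these pairs form a permutation of Z/k whose differences
   are pairwise distinct.  For k = 4 this is impossible, because the differences
   sum to 0 and 0 + 1 + 2 + 3 is not 0 in Z/4.  For 3-lists it forces the lists
   of r and r+1 to be equal: cut at an edge with different lists, or, if all the
   lists are equal, use the position in the common list as coordinate and t = 1.

   Lower bound 4 for correspondence covers: permutations of three colours that
   differ everywhere have the same parity, so a 3-fold cover whose matchings are
   trivial except for one transposition has no packing. *)

Set Implicit Arguments.
Unset Strict Implicit.
Unset Printing Implicit Defensive.

Import GRing.Theory.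

(** * Covers as projections to the base graph *)

(* The projection of a cover to its base graph; its fibres are the sets L v. *)
Record fibration (G H : sgraph) (pi : H -> G) : Prop := Fibration {
  fib_edge : forall x y : H, sedge x y -> pi x != pi y -> sedge (pi x) (pi y);
  fib_clique : forall x y : H, pi x = pi y -> x != y -> sedge x y;
  fib_uniq : forall x y z : H, sedge x y -> sedge x z ->
    pi y = pi z -> pi x != pi y -> y = z
}.

Definition fibre (G H : sgraph) (pi : H -> G) (v : G) : {set H} :=
  [set x | pi x == v].

Lemma sedge_neq (G : sgraph) (x y : G) : sedge x y -> x != y.
Proof. by apply: contraTneq => ->; rewrite sedge_irr. Qed.

Lemma cover_fibration (G H : sgraph) (L : G -> {set H}) :
  correspondence_cover L ->
  exists2 pi : H -> G, fibration pi & forall v, L v = fibre pi v.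
Proof.
move=> [disjL fullL nadjL adjL cliqueL].
have [pi piP] : exists pi : H -> G, forall x, x \in L (pi x).
  apply: (@fin_all_exists _ _ (fun x v => x \in L v)) => x.
  have : x \in \bigcup_(v : G) L v by rewrite fullL inE.
  by case/bigcupP=> v _ xv; exists v.
have LE v x : (x \in L v) = (pi x == v).
  apply/idP/eqP => [xv | <- //]; apply/eqP; apply: contraLR xv => /disjL.
  by move/disjointFr=> ->.
have mem_between x y u v : pi x = u -> pi y = v -> sedge x y ->
    [set x; y] \in edges_between (L u) (L v).
  move=> xu yv exy; apply/imset2P; exists x y => //; rewrite ?inE LE ?xu //.
  by rewrite yv eqxx.
exists pi; last by move=> v; apply/setP=> x; rewrite inE LE.
split=> [x y exy nxy | x y xy nxy | x y z exy exz yz nxy].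
- apply: contraLR exy => /(nadjL _ _ nxy) E; apply/negP=> exy.
  by have:= mem_between _ _ _ _ erefl erefl exy; rewrite E inE.
- by apply: (cliqueL (pi x)); rewrite // xy.
have guv : sedge (pi x) (pi y).
  apply: contraT => /(nadjL _ _ nxy) E.
  by have:= mem_between _ _ _ _ erefl erefl exy; rewrite E inE.
have Mxy := mem_between _ _ _ _ erefl erefl exy.
have Mxz := mem_between _ _ _ _ erefl (esym yz) exz.
have /trivIsetP trM := adjL _ _ guv.
(* Distinct edges of the matching are disjoint, but these two share [x]. *)
have [E|/(trM _ _ Mxy Mxz)/disjointFr/(_ (set21 x y))] :=
  eqVneq [set x; y] [set x; z]; last by rewrite set21.
have := set22 x y; rewrite E !inE eq_sym (negbTE (sedge_neq exy)) /=.
by move/eqP.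
Qed.

Lemma fibration_cover (G H : sgraph) (pi : H -> G) :
  fibration pi -> correspondence_cover (fibre pi).
Proof.
move=> [piE piC piU]; split=> [u v nuv | | u v nuv | u v euv | v x y].
- apply/pred0P=> x /=; rewrite !inE; apply/negP=> /andP[/eqP-> /eqP uv].
  by rewrite uv eqxx in nuv.
- by apply/setP=> x; rewrite inE; apply/bigcupP; exists (pi x); rewrite ?inE.
- apply: contraNeq => /set0Pn[_ /imset2P[x y + + _]].
  rewrite !inE => /eqP xu /andP[/eqP yv exy].
  by rewrite -xu -yv piE // xu yv.
- have nuv := sedge_neq euv.
  apply/trivIsetP=> _ _ /imset2P[x y] + + -> /imset2P[x' y'] + + ->.
  rewrite !inE => /eqP xu /andP[/eqP yv exy] /eqP xu' /andP[/eqP yv' exy'].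
  apply: contraR => /pred0Pn[z /andP[]] /=; rewrite !inE.
  have nxy : pi x != pi y by rewrite xu yv.
  (* The shared vertex is [x = x'], [x = y'], [y = x'] or [y = y']; in the two mixed cases it would
     lie over both [u] and [v]. *)
  case/orP=> /eqP-> /orP[] /eqP E; apply/eqP.
  + by congr [set _; _]; rewrite // (piU x y y') // ?yv // E.
  + by move: nuv; rewrite -xu -yv' E eqxx.
  + by move: nuv; rewrite -xu' -yv E eqxx.
  + suff <- : x = x' by rewrite E.
    apply: (piU y); last by rewrite eq_sym.
    + by rewrite sedge_sym.
    + by rewrite sedge_sym E.
    + by rewrite xu.
- by rewrite !inE => /eqP xv /eqP yv; apply: piC; rewrite xv.
Qed.

Lemma list_cover_fibration (G : sgraph) (L : G -> {fset nat}) :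
  fibration (tag : list_cover L -> G).
Proof.
split=> [x y | x y xy nxy | x y z].
- by move=> /= /orP[/andP[/eqP-> _]|/andP[-> //]]; rewrite eqxx.
- by apply/orP; left; rewrite nxy andbT; apply/eqP.
- move=> /= /orP[]/andP[exy /eqP cxy]; first by rewrite (eqP exy) eqxx.
  move=> /orP[]/andP[exz /eqP cxz] yz; first by rewrite (eqP exz) yz eqxx.
  have {cxy cxz} := esym (etrans (esym cxz) cxy); move: yz {exy exz}.
  case: y z => [v y] [w z] /= vw; case: w / vw z => z E _.
  by congr Tagged; apply: val_inj; rewrite -/(fsval _).
Qed.

Lemma card_list_cover_fibre (G : sgraph) (L : G -> {fset nat}) (v : G) :
  #|fibre (tag : list_cover L -> G) v| = #|` L v|%fset.
Proof.
rewrite cardfE -cardsT -(card_imset _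
  (fun _ _ => @eq_from_Tagged _ (fun v => L v) v _ _)).
apply: eq_card => x; rewrite inE; apply/eqP/imsetP => [<-|[y _ ->] //].
by exists (tagged x); case: x.
Qed.

Lemma list_cover_fold (k : nat) (G : sgraph) (L : G -> {fset nat}) :
  list_assignment k L -> fold_cover k (fibre (tag : list_cover L -> G)).
Proof.
move=> Lk; split; first exact: fibration_cover (list_cover_fibration L).
by move=> v; rewrite card_list_cover_fibre Lk.
Qed.

Lemma colorableP (H : sgraph) (k : nat) :
  reflect (exists f : H -> 'I_k, forall x y, sedge x y -> f x <> f y)
          (colorable H k).
Proof.
apply: (iffP existsP) => [[f /forallP fP] | [f fP]].
  by exists f => x y exy; move/forallP/(_ y)/implyP: (fP x) => /(_ exy)/eqP.
exists [ffun x => f x]; apply/forallP=> x; apply/forallP=> y; apply/implyP.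
by move/fP/eqP; rewrite !ffunE.
Qed.

Lemma chi_colorable (H : sgraph) : colorable H (chi H).
Proof. by rewrite /chi; case: ex_minnP. Qed.

(** A fibre is a clique, so a fibre of size [k] already needs [k] colours. *)
Lemma chi_fibration (G H : sgraph) (pi : H -> G) (v : G) (k : nat) :
  fibration pi -> #|fibre pi v| = k -> colorable H k -> chi H = k.
Proof.
move=> piF card_v Hk; apply/eqP; rewrite /chi; case: ex_minnP => j Hj minj.
rewrite eqn_leq minj //=; case/colorableP: Hj => f fP.
rewrite -card_v -[j]card_ord -(@card_in_imset _ _ f) ?max_card // => x y.
rewrite !inE => /eqP xv /eqP yv fxy; apply/eqP; apply: contraT => nxy.
by have /fP := fib_clique piF (etrans xv (esym yv)) nxy.
Qed.

(** * Extending injections, and walks with prescribed ends *)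

Lemma extend_injection (T U : finType) (A B : {set T}) (g : T -> U) :
  B \subset A -> #|A| <= #|U| -> {in B &, injective g} ->
  exists2 h : T -> U, {in A &, injective h} & {in B, h =1 g}.
Proof.
move=> sBA leAU injg; pose C := ~: (g @: B).
have leC : #|A :\: B| <= #|C|.
  by rewrite cardsDS // [leqRHS]cardsCs setCK (card_in_imset injg) leq_sub2r.
(* The i-th element of [A :\: B] goes to the i-th value missed by [g] on [B]. The default [g x] is
   never reached for [x] in [A], by the cardinality bound. *)
pose h x := if x \in B then g x else nth (g x) (enum C) (index x (enum (A :\: B))).
have idxC x : x \in A -> x \notin B -> index x (enum (A :\: B)) < size (enum C).
  move=> xA xB; rewrite -cardE (leq_trans _ leC) // cardE index_mem mem_enum.
  by rewrite inE xB.
have hC x : x \in A -> x \notin B -> h x \in C.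
  by move=> xA xB; rewrite /h (negbTE xB) -mem_enum mem_nth // idxC.
exists h => [x y xA yA | x xB]; last by rewrite /h xB.
have [xB|xB] := boolP (x \in B); have [yB|yB] := boolP (y \in B).
- by rewrite /h xB yB; apply: injg.
- move=> E; have := hC y yA yB; rewrite -E /h xB inE imset_f //.
- move=> E; have := hC x xA xB; rewrite E /h yB inE imset_f //.
rewrite /h (negbTE xB) (negbTE yB) (set_nth_default (g x) (g y)) ?idxC //.
move/eqP; rewrite nth_uniq ?idxC ?enum_uniq // => /eqP.
by apply: (index_inj x); rewrite mem_enum inE ?xB ?yB.
Qed.

(** For two steps, a third element serves as midpoint, even if [a = b]. A longer walk first goes to
    some [c != b] and then steps to [b]. *)
Lemma walk_between (T : finType) (a b : T) (m : nat) : 2 < #|T| -> 1 < m ->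
  exists s : nat -> T, [/\ s 0 = a, s m = b & forall i, i < m -> s i != s i.+1].
Proof.
move=> T3; case: m => [|[|m]] // _; elim: m b => [|m IHm] b.
  have [c] : exists c, c \notin [set a; b].
    apply/existsP; rewrite -negb_forall; apply: contraL T3 => /forallP all_ab.
    rewrite -leqNgt (leq_trans _ (_ : #|[set a; b]| <= 2)) //; last first.
      by rewrite cards2; case: eqP.
    by apply: subset_leq_card; apply/subsetP=> c _; apply: all_ab.
  rewrite !inE negb_or => /andP[ca cb].
  exists (fun i => if i is i'.+1 then if i' is 0 then c else b else a).
  by split=> // [] [|[|]] //; rewrite eq_sym.
have [c cb] : exists c, c != b.
  apply/existsP; rewrite -negb_forall; apply: contraL T3 => /forallP all_b.
  rewrite -leqNgt (leq_trans _ (_ : #|[set b]| <= 2)) //; last by rewrite cards1.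
  by apply: subset_leq_card; apply/subsetP=> c _; rewrite inE all_b.
have [s [s0 sm sP]] := IHm c.
exists (fun i => if i == m.+3 then b else s i); split; rewrite ?eqxx // => i.
rewrite ltnS leq_eqVlt => /orP[/eqP->|im]; first by rewrite eqxx ltn_eqF // sm.
by rewrite eqSS !ltn_eqF ?sP // ltnW.
Qed.

(** * Positions along the cut cycle *)

Section CutCycle.
Variables (n : nat) (r : 'I_n).

(** This is [i - (r + 1)] modulo [n], the position on the path from [ordS r] to [r]. Adding
    [n - r.+1] avoids truncated subtraction. *)
Definition cut_pos (i : 'I_n) : nat := (i + (n - r.+1)) %% n.

Lemma cut_pos_lt i : cut_pos i < n.
Proof. by rewrite ltn_mod (leq_trans _ (ltn_ord i)). Qed.

Lemma cut_pos_inj : injective cut_pos.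
Proof.
move=> i j /eqP; rewrite eqn_modDr !modn_small // => /eqP; exact: val_inj.
Qed.

Lemma cut_pos_cut : cut_pos r = n.-1.
Proof.
rewrite /cut_pos -[RHS](@modn_small _ n); last first.
  by rewrite ltn_predL (leq_trans _ (ltn_ord r)).
congr (_ %% _); have := ltn_ord r; case: n r => //= m [i /= _] im.
by rewrite subSS subnKC.
Qed.

Lemma cut_posS i : cut_pos (ordS i) = (cut_pos i).+1 %% n.
Proof. by rewrite /cut_pos /= modnDml -(addn1 (_ %% _)) modnDml addn1 addSn. Qed.

Lemma cut_pos0 : cut_pos (ordS r) = 0.
Proof.
by rewrite cut_posS cut_pos_cut prednK ?modnn // (leq_trans _ (ltn_ord r)).
Qed.

Lemma cut_pos_step i : i != r -> cut_pos (ordS i) = (cut_pos i).+1.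
Proof.
move=> nir; rewrite cut_posS modn_small //.
have n_gt0 : 0 < n by rewrite (leq_trans _ (ltn_ord r)).
rewrite -[X in _ < X](prednK n_gt0) ltnS ltn_neqAle -cut_pos_cut (inj_eq cut_pos_inj).
by rewrite nir cut_pos_cut -ltnS prednK // cut_pos_lt.
Qed.
End CutCycle.

(** * Coordinates on a cover of the cut cycle *)

Section CycleCover.
Variables (n k : nat) (H : sgraph) (pi : H -> cycle_graph n) (r : 'I_n).
Hypotheses (n3 : 2 < n) (piF : fibration pi).

Lemma cycle_cover_edge (x y : H) : sedge x y -> 
  [\/ pi x = pi y, pi y = ordS (pi x) | pi x = ordS (pi y)].
Proof.
move=> exy; have [|nxy] := eqVneq (pi x) (pi y); first by constructor 1.
by have /= /andP[_ /orP[]/eqP] := fib_edge piF exy nxy; [constructor 2|constructor 3].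
Qed.

Lemma ordS_neq (i : 'I_n) : ordS i != i.
Proof.
apply/eqP=> /(congr1 val) /=; have:= ltn_ord i; rewrite leq_eqVlt => /orP[/eqP E|lt].
  by rewrite E modnn => i0; have := n3; rewrite -E -i0.
by rewrite modn_small // => /eqP; rewrite gtn_eqF.
Qed.

Definition coordinate (c : H -> 'I_k) : Prop :=
  (forall x y, pi x = pi y -> c x = c y -> x = y) /\
  (forall x y, sedge x y -> pi y = ordS (pi x) -> pi x != r -> c x = c y).

(** The fibres are treated in the order of their positions. A vertex matched to the previous fibre
    copies the coordinate of its partner; this partial map is injective because the edges form a
    matching, and [extend_injection] completes it on the fibre. *)
Lemma coordinate_exists :
  0 < k -> (forall v, #|fibre pi v| <= k) -> exists c, coordinate c.
Proof.
move=> k0 cardk; pose pos x := cut_pos r (pi x).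
have ordSr x y : pi y = ordS (pi x) -> pi x != r -> pos y = (pos x).+1.
  by rewrite /pos => -> /cut_pos_step->.
suff /(_ n)[c [cI cE]] : forall m, exists c : H -> 'I_k,
    (forall x y, pos x < m -> pos x = pos y -> c x = c y -> x = y) /\
    (forall x y, pos y < m -> sedge x y -> pos y = (pos x).+1 -> c x = c y).
  exists c; split=> [x y xy | x y exy yx xr]; last first.
    by apply: cE; rewrite // ?cut_pos_lt //; apply: ordSr.
  by apply: cI; rewrite ?cut_pos_lt // /pos xy.
elim=> [|m [c [cI cE]]]; first by exists (fun _ => Ordinal k0).
pose A := [set y | pos y == m].
pose up y := [pred x | sedge x y & (pos x).+1 == m].
pose B := [set y in A | [exists x, up y x]].
(* The default [y] is irrelevant on [B], and the partner picked is unique by [fib_uniq]. *)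
pose g y := c (odflt y [pick x | up y x]).
have gE x y : y \in A -> up y x -> g y = c x /\ y \in B.
  move=> yA upx; rewrite inE yA /=; split; last by apply/existsP; exists x.
  rewrite /g; case: pickP => [z /= | /(_ x)]; last by rewrite upx.
  case/andP: upx => exy /eqP xm /andP[ezy /eqP zm]; congr c.
  apply: (fib_uniq piF (x := y)); rewrite 1?sedge_sym //.
    by apply: (@cut_pos_inj _ r); apply: succn_inj; rewrite -/(pos _) zm.
  apply/eqP=> /(congr1 (cut_pos r)) /eqP; rewrite -!/(pos _) -(inj_eq succn_inj).
  by move: yA; rewrite inE => /eqP->; rewrite zm gtn_eqF.
have [|||h hI hE] := @extend_injection _ _ A B g.
- by apply/subsetP=> x; rewrite inE => /andP[].
- rewrite card_ord; have [->|[x]] := set_0Vmem A; first by rewrite cards0.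
  rewrite inE => /eqP xm; apply: leq_trans (cardk (pi x)).
  apply: subset_leq_card; apply/subsetP=> y; rewrite !inE -xm.
  by rewrite (inj_eq (@cut_pos_inj _ r)).
- move=> y y'; rewrite !inE => /andP[ym /existsP[x upx]] /andP[ym' /existsP[x' upx']].
  have [] := gE x y _ upx; rewrite ?inE // => -> _.
  have [] := gE x' y' _ upx'; rewrite ?inE // => -> _.
  case/andP: upx upx' => exy /eqP xm /andP[exy' /eqP xm'] E.
  have xx' : x = x' by apply: cI => //; [rewrite -xm | apply: succn_inj; rewrite xm].
  rewrite -xx' in exy'; apply: (fib_uniq piF exy exy').
    by apply: (@cut_pos_inj _ r); rewrite -!/(pos _) (eqP ym) (eqP ym').
  apply/eqP=> /(congr1 (cut_pos r)); rewrite -!/(pos _) (eqP ym) => xm0.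
  by move: xm; rewrite xm0 => /eqP; rewrite gtn_eqF.
exists (fun x => if pos x == m then h x else c x).
split=> [x y xm xy | x y ym exy xy].
  rewrite -xy; case: eqP xm => [xm _ | xm]; last first.
    by rewrite ltnS leq_eqVlt => /orP[/eqP//|xm']; apply: cI.
  by apply: hI; rewrite inE ?xm // -xy xm.
case: (eqVneq (pos y) m) ym => [ym _ | ym]; last first.
  rewrite ltnS leq_eqVlt (negbTE ym) /= => ym'; rewrite ltn_eqF; first exact: cE.
  by rewrite (leq_trans _ ym') // ltnS -ltnS -xy ltnW.
have [||E yB] := gE x y; first by rewrite inE ym.
  by rewrite /= exy -xy ym eqxx.
by rewrite ltn_eqF -?ym ?xy // hE // E.
Qed.
End CycleCover.

(** * Colouring by shifted coordinates *)

Lemma shift_colorable (n k : nat) (H : sgraph) (pi : H -> cycle_graph n)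
    (r : 'I_n) (c : H -> 'I_k.+3) (t : 'I_k.+3) :
  2 < n -> fibration pi -> coordinate pi r c ->
  (forall x y, sedge x y -> pi x = r -> pi y = ordS r -> c y != (c x + t)%R) ->
  colorable H k.+3.
Proof.
move=> n3 piF [cI cE] ct; pose pos x := cut_pos r (pi x).
(* The cut cycle is a path with [n.-1] edges, at least two since [n >= 3]. *)
have [||s [s0 st sS]] := @walk_between 'I_k.+3 0%R t n.-1.
- by rewrite card_ord.
- by rewrite -ltnS prednK // ltnW // ltnW.
suff fP x y : sedge x y -> pi x = pi y \/ pi y = ordS (pi x) ->
    (c x + s (pos x) <> c y + s (pos y))%R.
  apply/colorableP; exists (fun x => c x + s (pos x))%R => x y exy.
  have [xy|yx|xy] := cycle_cover_edge piF exy; first by apply: fP => //; left.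
    by apply: fP => //; right.
  by apply/nesym; apply: fP; rewrite 1?sedge_sym //; right.
move=> exy [xy|yx].
  rewrite /pos xy => /addIr /(cI _ _ xy) E.
  by have := sedge_neq exy; rewrite E eqxx.
have [xr|xr] := eqVneq (pi x) r.
  rewrite /pos yx xr cut_pos0 cut_pos_cut s0 st addr0 => E.
  by have := ct x y exy xr; rewrite yx xr E eqxx => /(_ erefl).
rewrite -(cE _ _ exy yx xr) /pos yx cut_pos_step // => /addrI /eqP; apply/negP.
apply: sS; have := cut_pos_lt r (ordS (pi x)); rewrite cut_pos_step //.
by rewrite ltn_predRL.
Qed.

(** If no shift gives a colouring, each [t] is blocked by an edge from [g t] to [h t] over the cut.
    By the matching property either end determines the edge, and the edge determines [t] as its
    coordinate difference; hence both injectivity claims. *)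
Lemma colorable_or_all_shifts (n k : nat) (H : sgraph) (pi : H -> cycle_graph n)
    (r : 'I_n) :
  2 < n -> fibration pi -> (forall v, #|fibre pi v| <= k.+3) ->
  colorable H k.+3 \/
  exists (c g h : _), [/\ injective (c \o g : 'I_k.+3 -> 'I_k.+3),
    injective (c \o h),
    (forall x y, pi x = pi y -> c x = c y -> x = y) &
    forall t, [/\ sedge (g t) (h t), pi (g t) = r, pi (h t) = ordS r &
      c (h t) = c (g t) + t]%R].
Proof.
move=> n3 piF cardk.
have [c cP] := coordinate_exists r piF (ltn0Sn k.+2) cardk.
pose bad t (xy : H * H) := [&& sedge xy.1 xy.2, pi xy.1 == r,
  pi xy.2 == ordS r & c xy.2 == c xy.1 + t]%R.
have [/forallP all_bad | ] := boolP [forall t, [exists xy, bad t xy]]; last first.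
  rewrite negb_forall => /existsP[t]; rewrite negb_exists => /forallP tP; left.
  apply: (shift_colorable n3 piF cP (t := t)) => x y exy xr yr.
  by have := tP (x, y); rewrite /bad /= exy xr yr !eqxx.
right; have [gh ghP] : exists gh, forall t, bad t (gh t).
  by apply: (@fin_all_exists _ _ bad) => t; apply/existsP/all_bad.
have {}ghP t : [/\ sedge (gh t).1 (gh t).2, pi (gh t).1 = r,
    pi (gh t).2 = ordS r & c (gh t).2 = c (gh t).1 + t]%R.
  by have /and4P[? /eqP ? /eqP ? /eqP ?] := ghP t.
have nrS : r <> ordS r by apply/eqP; rewrite eq_sym ordS_neq.
exists c, (fun t => (gh t).1), (fun t => (gh t).2); have [cI _] := cP.
split=> // t u /= E; have [et gt ht ct] := ghP t; have [eu gu hu cu] := ghP u.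
  have gE : (gh t).1 = (gh u).1 by apply: cI; rewrite // gt.
  suff hE : (gh t).2 = (gh u).2 by move: ct; rewrite hE gE cu => /addrI.
  by apply: (fib_uniq piF et); rewrite ?gE ?ht ?hu ?gu //; apply/eqP.
have hE : (gh t).2 = (gh u).2 by apply: cI; rewrite // ht.
suff gE : (gh t).1 = (gh u).1 by move: ct; rewrite hE gE cu => /addrI.
apply: (@fib_uniq _ _ _ piF (gh t).2); rewrite 1?sedge_sym ?gt ?gu ?ht //.
  by rewrite hE.
by rewrite ordS_neq.
Qed.

(** * Upper bounds for 4-fold covers and 3-lists *)

Lemma sum_injective (n : nat) (f : 'I_n.+1 -> 'I_n.+1) :
  injective f -> (\sum_i f i = \sum_i i)%R.
Proof. by move=> fI; rewrite [RHS](reindex_inj fI). Qed.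

(** If both maps were permutations, then S + S = S for the sum S of all elements of Z/4, whereas S =
    2. *)
Lemma no_complete_mapping4 (f : 'I_4 -> 'I_4) :
  injective f -> ~ injective (fun i => f i + i)%R.
Proof.
move=> /sum_injective fS /sum_injective; rewrite big_split /= fS => /eqP.
rewrite -[X in _ == X]addr0 (inj_eq (addrI _)) !big_ord_recl big_ord0.
by [].
Qed.

Lemma cycle_cover_colorable4 (n : nat) (H : sgraph) (pi : H -> cycle_graph n) :
  2 < n -> fibration pi -> (forall v, #|fibre pi v| <= 4) -> colorable H 4.
Proof.
move=> n3 piF card4; have n0 : 0 < n by rewrite ltnW // ltnW.
have [//|[c [g [h [gI hI _ ghP]]]]] :=
  colorable_or_all_shifts (Ordinal n0) n3 piF card4.
case: (no_complete_mapping4 gI) => t u E; apply: hI => /=.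
by have [_ _ _ ->] := ghP t; have [_ _ _ ->] := ghP u.
Qed.

Lemma cycle_list_cover_colorable3 (n : nat) (L : cycle_graph n -> {fset nat}) :
  2 < n -> list_assignment 3 L -> colorable (list_cover L) 3.
Proof.
move=> n3 L3; have n0 : 0 < n by rewrite ltnW // ltnW.
have piF := list_cover_fibration L.
have colE (x y : list_cover L) : sedge x y -> tag y = ordS (tag x) ->
    list_cover_color x = list_cover_color y.
  move=> /= /orP[/andP[/eqP xy _] yx | /andP[_ /eqP//]].
  by have := ordS_neq n3 (tag x); rewrite -yx xy eqxx.
have [/forallP Leq | ] := boolP [forall i : 'I_n, L i == L (ordS i)].
  pose c (x : list_cover L) : 'I_3 :=
    inord (index (list_cover_color x) (L (tag x))).
  have idx3 (x : list_cover L) : index (list_cover_color x) (L (tag x)) < 3.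
    by rewrite -(L3 (tag x)) index_mem; apply: fsvalP.
  have cE (x y : list_cover L) : sedge x y -> tag y = ordS (tag x) -> c x = c y.
    by move=> exy yx; rewrite /c yx -(eqP (Leq _)) (colE x y exy yx).
  (* With equal lists [c] is constant across the cut edge too, so the nonzero shift 1 is not
     blocked. *)
  apply: (@shift_colorable n 0 (list_cover L) tag (Ordinal n0) c 1%R) => //.
    split=> [x y xy /(congr1 val) /= | x y exy yx _]; last exact: cE.
    have colx : list_cover_color x \in L (tag y) by rewrite -xy; apply: fsvalP.
    rewrite !inordK // xy => /(index_inj 0 colx (fsvalP _)) {colx}.
    case: x y xy => [v x] [w y] /= vw; case: w / vw y => y E.
    by congr Tagged; apply: val_inj.
  move=> x y exy xr yr; rewrite (cE x y exy) ?xr //.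
  by rewrite -subr_eq0 opprD addrA subrr add0r.
rewrite negb_forall => /existsP[r Lr].
have [|//|[c [g [h [gI _ cI ghP]]]]] := colorable_or_all_shifts (k := 0) r n3 piF.
  by move=> v; rewrite card_list_cover_fibre L3.
(* Since [c \o g] is onto, every vertex over [r] is some [g t], so it has a neighbour of the same
   list colour over [ordS r]. This gives inclusion of the lists, and equality by size. *)
case/negP: Lr; rewrite eqEfcard !L3 leqnn andbT; apply/fsubsetP=> a ar.
pose x : list_cover L := Tagged (fun v => L v) [` ar]%fset.
have [t ct] : exists t, c (g t) = c x.
  by have [f _ fK] := injF_bij gI; exists (f (c x)); apply: fK.
have [e gr hr _] := ghP t; have gx : g t = x by apply: cI.
rewrite gx in e; have /= := colE _ _ e hr.
by rewrite /list_cover_color /= => ->; rewrite -hr; apply: fsvalP.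
Qed.

(** * Lower bound for list covers *)

(** [F v a] is the index of the packed colouring that uses [a] at [v]. Taking [a] in [nat] keeps the
    dependent pairs out of the lower-bound arguments. *)
Lemma list_cover_packing (k : nat) (G : sgraph) (L : G -> {fset nat}) :
  colorable (list_cover L) k -> exists F : G -> nat -> nat,
  [/\ (forall v a, a \in L v -> F v a < k),
      (forall v a b, a \in L v -> b \in L v -> a != b -> F v a <> F v b) &
      (forall u v a, sedge u v -> a \in L u -> a \in L v -> F u a <> F v a)].
Proof.
case/colorableP=> f fP.
pose tg v (x : L v) : list_cover L := Tagged (fun v => L v) x.
pose F v a := oapp (fun x : L v => nat_of_ord (f (tg v x))) 0 (insub a).
have FE v a (av : a \in L v) : F v a = f (tg v [` av]%fset).
  by rewrite /F insubT.
exists F; split=> [v a av | v a b av bv nab | u v a uv au av]; rewrite !FE //.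
  move/val_inj; apply: fP; apply/orP; left; rewrite eqxx /=.
  by apply: contra_neq nab => E; have /(congr1 val) := eq_from_Tagged E.
move/val_inj; apply: fP; rewrite /= /list_cover_edge /= uv orbC.
by rewrite /list_cover_color /= eqxx.
Qed.

Lemma cycle_edgeS (n : nat) (i : 'I_n) : 2 < n -> cycle_edge i (ordS i).
Proof. by move=> n3; rewrite /cycle_edge /= eqxx eq_sym ordS_neq. Qed.

Lemma uncolorable_list_cover1 (n : nat) : 2 < n -> exists2 L,
  list_assignment 1 (L : cycle_graph n -> _) & ~~ colorable (list_cover L) 1.
Proof.
move=> n3; have n0 : 0 < n by rewrite ltnW // ltnW.
exists (fun=> [fset 0]%fset); first by move=> v; rewrite cardfs1.
apply/negP=> /list_cover_packing[F [F1 _ Fe]]; pose i := Ordinal n0.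
apply: (Fe i (ordS i) 0); rewrite ?in_fset1 //; first exact: cycle_edgeS.
have F0 v : F v 0 = 0 by apply/eqP; rewrite -leqn0 -ltnS F1 // in_fset1.
by rewrite !F0.
Qed.

(* The colour of i in the list of i is the same for all i; this conflicts with
   the colour 1, which the lists of the vertices n-1 and 0 share. *)
Lemma uncolorable_list_cover2 (n : nat) : 2 < n -> exists2 L,
  list_assignment 2 (L : cycle_graph n -> _) & ~~ colorable (list_cover L) 2.
Proof.
case: n => // n n3.
pose L : cycle_graph n.+1 -> {fset nat} := fun i : 'I_n.+1 =>
  [fset (i : nat); if i == n :> nat then 1 else i.+1]%fset.
exists L => [i|].
  rewrite cardfs2; case: (eqVneq (i : nat) n) => [->|_]; last by rewrite ltn_eqF.
  by rewrite gtn_eqF.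
apply/negP=> /list_cover_packing[F [F2 Fv Fe]].
have eq2 a b c : a < 2 -> b < 2 -> c < 2 -> a <> b -> b <> c -> a = c.
  by case: a b c => [|[|a]] [|[|b]] [|[|c]].
pose v i : 'I_n.+1 := inord i.
have vE i : i <= n -> v i = i :> nat by move=> ?; rewrite inordK.
have vS i : i < n -> v i.+1 = ordS (v i).
  by move=> lin; apply: val_inj; rewrite /= (vE _ lin) (vE _ (ltnW lin)) modn_small.
have own i : i <= n -> i \in L (v i) by move=> lin; rewrite !inE vE // eqxx.
have next i : i < n -> i.+1 \in L (v i).
  by move=> lin; rewrite !inE vE 1?ltnW // ltn_eqF // eqxx orbT.
have Fi i : i <= n -> F (v i) i = F (v 0) 0.
  elim: i => // i IHi lin; have lin' := ltnW lin; rewrite -IHi //; apply/esym.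
  apply: (eq2 _ (F (v i) i.+1)); rewrite ?F2 ?own ?next //.
    by apply: Fv; rewrite ?own ?next // neq_ltn leqnn.
  by apply: Fe; rewrite ?own ?next // vS //; apply: cycle_edgeS.
have last1 : 1 \in L (v n) by rewrite !inE vE // eqxx eqxx orbT.
have n0 : 0 < n by rewrite ltnW.
apply: (Fe (v n) (v 0) 1); rewrite ?next //.
  suff -> : v 0 = ordS (v n) by apply: cycle_edgeS.
  by apply: val_inj; rewrite /= !vE // modnn.
(* Both values differ from [F (v n) n = F (v 0) 0], and only two values are available. *)
apply: (eq2 _ (F (v n) n)); rewrite ?F2 ?own ?next //.
  by apply: Fv; rewrite ?own // ltn_eqF.
by rewrite Fi //; apply: Fv; rewrite ?own ?next.
Qed.

(** * Lower bound for correspondence covers: twisted covers *)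

Section Twist.
Variables (n : nat) (tw : 'I_n -> {perm 'I_3}).

Definition twist_up (x y : 'I_n * 'I_3) : bool :=
  (y.1 == ordS x.1) && (y.2 == tw x.1 x.2).

Definition twist_edge : rel ('I_n * 'I_3) :=
  [rel x y | if x.1 == y.1 then x.2 != y.2 else twist_up x y || twist_up y x].

Lemma twist_sym : symmetric twist_edge.
Proof. by move=> x y; rewrite /twist_edge /= eq_sym orbC (eq_sym x.2). Qed.

Lemma twist_irr : irreflexive twist_edge.
Proof. by move=> x; rewrite /twist_edge /= !eqxx. Qed.

Definition twist_cover : sgraph := SGraph twist_sym twist_irr.

Definition twist_proj (x : twist_cover) : cycle_graph n := x.1.

(** As [n >= 3], the successor and the predecessor of a vertex differ, so two edges from [x] into
    one other fibre have the same direction. They then coincide because [tw] consists of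
    permutations. *)
Lemma twist_fibration : 2 < n -> fibration twist_proj.
Proof.
move=> n3; have ordSS (i : 'I_n) : ordS (ordS i) != i.
  have i_lt := ltn_ord i; apply/eqP=> /(congr1 val) /=.
  rewrite -[_.+1 in X in X = _]addn1 modnDml addn1 => E.
  have : i.+2 = i + 0 %[mod n] by rewrite E addn0 modn_small.
  by move/eqP; rewrite -addn2 eqn_modDl mod0n modn_small.
rewrite /twist_proj; split=> [x y | x y xy nxy | x y z].
- move=> + nxy; rewrite /= /twist_edge /= (negbTE (nxy : x.1 != y.1 :> 'I_n)).
  rewrite /cycle_edge /= nxy => /orP[]/andP[/eqP-> _].
    by rewrite eqxx.
  by rewrite eqxx orbT.
- rewrite /= /twist_edge /= xy eqxx; apply: contra_neq nxy.
  case: x y xy => [i p] [j q] /=.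
  by move=> -> ->.
move=> + + yz nxy; rewrite /= /twist_edge /= -yz (negbTE (nxy : x.1 != y.1 :> 'I_n)).
rewrite /twist_up -yz => /orP[] /andP[/eqP y1 /eqP y2] /orP[]/andP[/eqP z1 /eqP z2].
- by apply: injective_projections; rewrite // y2.
- by have := ordSS x.1; rewrite -y1 -z1 eqxx.
- by have := ordSS x.1; rewrite -z1 -y1 eqxx.
- by apply: injective_projections => //; apply: (@perm_inj _ (tw y.1)); rewrite -y2 z2 yz.
Qed.

Lemma card_twist_fibre (v : 'I_n) : #|fibre twist_proj v| = 3.
Proof.
rewrite -[RHS]card_ord -(@card_imset _ _ (fun p : 'I_3 => (v, p) : twist_cover)).
  apply: eq_card => -[i p]; rewrite inE /twist_proj /=.
  by apply/eqP/imsetP => [->|[q _ [-> _]]] //; exists p.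
by move=> p q [].
Qed.

Lemma twist_fold : 2 < n -> fold_cover 3 (fibre twist_proj).
Proof.
by move=> n3; split; [apply/fibration_cover/twist_fibration|apply: card_twist_fibre].
Qed.
End Twist.

(* The differences b i - a i are nonzero and sum to 0 in Z/3, so they are all
   equal. *)
Lemma derangement3 (a b : 'I_3 -> 'I_3) :
  injective a -> injective b -> (forall i, a i <> b i) ->
  (a 1 - a 0 = b 1 - b 0)%R.
Proof.
move=> /sum_injective Sa /sum_injective Sb nab; pose d i := (b i - a i)%R.
have d0 i : d i != 0%R by rewrite subr_eq0 eq_sym; apply/eqP.
have : (\sum_i d i = 0)%R by rewrite big_split /= sumrN Sa Sb subrr.
suff dE : (\sum_i d i = 0 -> d 0 = d 1)%R.
  move=> /dE d01; have b0 : (b 0 = a 0 + d 0)%R by rewrite addrC subrK.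
  have b1 : (b 1 = a 1 + d 0)%R by rewrite d01 addrC subrK.
  by rewrite b1 b0 opprD addrACA subrr addr0.
rewrite !big_ord_recl big_ord0.
have -> : 1%R = lift ord0 ord0 :> 'I_3 by apply: val_inj.
(* Of the eight triples of nonzero residues modulo 3, only the two constant ones sum to 0. *)
case: (d 0%R) (d0 0%R) => [[|[|[|//]]] ?] //; 
  case: (d (lift ord0 ord0)) (d0 (lift ord0 ord0)) => [[|[|[|//]]] ?] //;
  case: (d _) (d0 (lift ord0 (lift ord0 ord0))) => [[|[|[|//]]] ?] //
  _ _ _ /eqP // _; exact: val_inj.
Qed.

(** A 3-colouring restricts to a permutation [a i] of Z/3 on each fibre, and [o i], which is 1 or 2,
    records its parity. By [derangement3] it is constant along the untwisted edges, while the
    transposition on the closing edge negates it; but no nonzero element of Z/3 is its own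
    negative. *)
Lemma twist_not_colorable (n : nat) : 2 < n.+1 ->
  exists tw : 'I_n.+1 -> {perm 'I_3}, ~~ colorable (twist_cover tw) 3.
Proof.
move=> n3; pose tw (i : 'I_n.+1) : {perm 'I_3} :=
  if i == ord_max then tperm 0%R 1%R else 1%g.
exists tw; apply/negP=> /colorableP[f fP].
pose a (i : 'I_n.+1) p := f (i, p).
have aI i : injective (a i).
  move=> p q E; apply/eqP; apply: contraT => npq.
  by case: (fP (i, p) (i, q)); rewrite /= /twist_edge /= ?eqxx.
have twI i : injective (fun p => a (ordS i) (tw i p)).
  by move=> p q /aI/perm_inj.
have nab i p : a i p <> a (ordS i) (tw i p).
  apply: fP; rewrite /= /twist_edge /= eq_sym (negbTE (ordS_neq n3 i)).
  by rewrite /twist_up /= !eqxx.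
have aS i := derangement3 (aI i) (twI i) (nab i).
pose o i := (a i 1 - a i 0)%R.
have oE i : i <= n -> o (inord i) = o ord0.
  elim: i => [|i IHi] lin; first by congr o; apply: val_inj; rewrite /= inordK.
  rewrite -IHi 1?ltnW // /o (aS (inord i)) /tw ifF ?perm1.
    suff -> : inord i.+1 = ordS (inord i : 'I_n.+1) by [].
    by apply: val_inj; rewrite /= !inordK 1?modn_small // 1?ltnW // ltnS ltnW.
  apply/eqP=> /(congr1 val); rewrite /= inordK 1?ltnW // => E.
    by rewrite E ltnn in lin.
have := oE n (leqnn n); have -> : inord n = ord_max :> 'I_n.+1.
  by apply: val_inj; rewrite /= inordK.
rewrite /o aS /tw eqxx tpermL tpermR.
have -> : ordS (ord_max : 'I_n.+1) = ord0 by apply: val_inj; rewrite /= modnn.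
rewrite -opprB; have : (a ord0 1 - a ord0 0 != 0)%R.
  by rewrite subr_eq0 (inj_eq (aI _)).
by case: (_ - _)%R => [[|[|[|//]]] ?] // _ /eqP.
Qed.

(** * The two packing numbers *)

Lemma list_packing_ge3 (n k : nat) : 2 < n -> 0 < k ->
  (forall L : cycle_graph n -> {fset nat}, list_assignment k L ->
    chi (list_cover L) = k) -> 3 <= k.
Proof.
move=> n3; case: k => [//|[|[|k]]] // _ chiE.
  have [L L1 /negP[]] := uncolorable_list_cover1 n3.
  by rewrite -[X in colorable _ X](chiE L L1) chi_colorable.
have [L L2 /negP[]] := uncolorable_list_cover2 n3.
by rewrite -[X in colorable _ X](chiE L L2) chi_colorable.
Qed.

Theorem theorem2 (n : nat) (hn : 3 <= n) :
  list_packing_number (cycle_graph n) 3 /\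
  correspondence_packing_number (cycle_graph n) 4.
Proof.
have n0 : 0 < n by rewrite ltnW // ltnW.
pose v0 : cycle_graph n := Ordinal n0.
split; split.
- split=> // L L3; apply: (chi_fibration (v := v0) (list_cover_fibration L)).
    by rewrite card_list_cover_fibre.
  exact: cycle_list_cover_colorable3.
- by move=> k [k0 chiE]; apply: list_packing_ge3 chiE.
- split=> // H L [Lcover L4]; have [pi piF LE] := cover_fibration Lcover.
  apply: (chi_fibration (v := v0) piF); first by rewrite -LE.
  by apply: cycle_cover_colorable4 piF _ => // v; rewrite -LE L4.
(* List covers are correspondence covers, so [3 <= k] carries over; the twisted cover excludes
   [k = 3]. *)
- move=> k [k0 chiE]; rewrite ltn_neqAle (@list_packing_ge3 n k) ?andbT //.
    apply: contraTneq isT => k3; rewrite -k3 in chiE.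
    case: n hn {n0 v0} chiE => // n n3 chiE.
    have [tw /negP[]] := twist_not_colorable n3.
    rewrite -[X in colorable _ X](chiE _ _ (twist_fold tw n3)).
    exact: chi_colorable.
  by move=> L Lk; apply: chiE (list_cover_fold Lk).
Qed.
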